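(* Let $\omega=\frac{-1+\sqrt{-3}}{2}$ and define the Lehmer-Euler numbers $W_n$ by $$\sum_{n=0}^\infty W_n\frac{t^n}{n!}=\frac{3}{e^{t}+e^{\omega t}+e^{\omega^2 t}}=\left(\sum_{l=0}^\infty\frac{t^{3l}}{(3l)!}\right)^{-1}.$$ Then for every non-negative integer $n$, $W_{3n}\in\mathbb{Z}$ and $W_{3n}\equiv(-1)^n\pmod 9$. *)

(* Defs.v *)
From HB Require Import structures.
From mathcomp Require Import all_boot all_order all_algebra.
From mathcomp Require Import ring.

Set Implicit Arguments.
Unset Strict Implicit.
Unset Printing Implicit Defensive.

Import Order.TTheory GRing.Theory Num.Theory.
Local Open Scope ring_scope.

(* [f : fps F] stands for the formal power series \sum_n f n * t^n. *)
Definition fps (F : fieldType) := nat -> F.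

Section FormalPowerSeries.
Variable F : fieldType.
Implicit Types f g : fps F.

Definition fps_const (a : F) : fps F := fun n => if n is 0%N then a else 0.

Definition fps_add f g : fps F := fun n => f n + g n.

Definition fps_mul f g : fps F :=
  fun n => \sum_(k < n.+1) f k * g (n - k)%N.

(* exp (a t) *)
Definition fps_exp (a : F) : fps F := fun n => a ^+ n / n`!%:R.

(* The first [n] coefficients of 1 / f: solving f * g = 1 for the coefficient
   g_m gives f_0 g_m = [m = 0] - \sum_(k < m) f_(m - k) g_k. *)
Definition fps_inv_coefs f (n : nat) : seq F :=
  iter n (fun s => rcons s
    (((size s == 0%N)%:R - \sum_(k < size s) f (size s - k)%N * s`_k) / f 0%N))
    [::].

(* Meaningful when f 0 != 0; see [fps_mulfV] and [fps_inv_unique]. *)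
Definition fps_inv f : fps F := fun n => (fps_inv_coefs f n.+1)`_n.

Definition fps_div f g : fps F := fps_mul f (fps_inv g).

Lemma size_fps_inv_coefs f n : size (fps_inv_coefs f n) = n.
Proof. by elim: n => //= n IHn; rewrite size_rcons IHn. Qed.

Lemma nth_fps_inv_coefs f n k :
  (k < n)%N -> (fps_inv_coefs f n)`_k = fps_inv f k.
Proof.
elim: n => // n IHn; rewrite ltnS leq_eqVlt => /predU1P [-> // | ltkn].
by rewrite /= nth_rcons size_fps_inv_coefs ltkn IHn.
Qed.

Lemma fps_invE f n :
  fps_inv f n =
    ((n == 0%N)%:R - \sum_(k < n) f (n - k)%N * fps_inv f k) / f 0%N.
Proof.
rewrite {1}/fps_inv /= nth_rcons size_fps_inv_coefs ltnn eqxx.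
by under eq_bigr => k _ do rewrite nth_fps_inv_coefs //.
Qed.

Lemma fps_mulC f g : fps_mul f g =1 fps_mul g f.
Proof.
move=> n; rewrite /fps_mul (reindex_inj rev_ord_inj) /=.
by apply: eq_bigr => k _; rewrite subSS mulrC subKn // -ltnS.
Qed.

Lemma fps_mulfV f : f 0%N != 0 -> fps_mul f (fps_inv f) =1 fps_const 1.
Proof.
move=> f0 n; rewrite fps_mulC /fps_mul big_ord_recr /= subnn [fps_inv f n]fps_invE.
rewrite divfK //; under eq_bigr => k _ do rewrite mulrC.
by rewrite addrC subrK; case: n.
Qed.

Lemma fps_inv_unique f g :
  f 0%N != 0 -> fps_mul f g =1 fps_const 1 -> g =1 fps_inv f.
Proof.
move=> f0 fg1; elim/ltn_ind => n IHn; apply: (mulIf f0).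
have := fg1 n; rewrite -(fps_mulfV f0 n) !(fps_mulC f) /fps_mul.
rewrite !big_ord_recr /= subnn; under eq_bigr => k _ do rewrite IHn //.
exact: addrI.
Qed.

Lemma eq_fps_inv f g : f =1 g -> fps_inv f =1 fps_inv g.
Proof.
move=> fg; elim/ltn_ind => n IHn; rewrite !fps_invE fg.
by under eq_bigr => k _ do rewrite fg IHn //.
Qed.

End FormalPowerSeries.

Section LehmerEuler.
Variable C : numClosedFieldType.

Definition omega : C := (-1 + sqrtC (-3)) / 2.

(* e^t + e^(omega t) + e^(omega^2 t) *)
Definition lehmer_euler_den : fps C :=
  fps_add (fps_add (fps_exp 1) (fps_exp omega)) (fps_exp (omega ^+ 2)).

Definition lehmer_euler_gf : fps C :=
  fps_div (fps_const 3) lehmer_euler_den.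

Definition lehmer_euler (n : nat) : C := n`!%:R * lehmer_euler_gf n.

(* \sum_l t^(3l) / (3l)! *)
Definition exp3_series : fps C :=
  fun n => if (3 %| n)%N then n`!%:R^-1 else 0.

Lemma omega_sum : 1 + omega + omega ^+ 2 = 0.
Proof.
suff -> : 1 + omega + omega ^+ 2 = (sqrtC (-3) ^+ 2 + 3) / 4 :> C.
  by rewrite sqrtCK addNr mul0r.
by rewrite /omega; field.
Qed.

Lemma omega3 : omega ^+ 3 = 1.
Proof.
have -> : omega ^+ 3 = (omega - 1) * (1 + omega + omega ^+ 2) + 1 by ring.
by rewrite omega_sum mulr0 add0r.
Qed.

Lemma lehmer_euler_denE n : lehmer_euler_den n = 3 * exp3_series n.
Proof.
rewrite /lehmer_euler_den /fps_add /fps_exp /exp3_series expr1n.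
rewrite -!mulrDl exprAC -(expr_mod n omega3) /dvdn.
have : (n %% 3 < 3)%N by rewrite ltn_mod.
case: (n %% 3)%N => [|[|[|]]] //= _.
- by rewrite expr0 expr1n; congr (_ * _); ring.
- by rewrite expr1 omega_sum mul0r mulr0.
- rewrite -exprM [omega ^+ (2 * 2)]exprS omega3 mulr1 addrAC omega_sum.
  by rewrite mul0r mulr0.
Qed.

Lemma lehmer_euler_den0 : lehmer_euler_den 0 != 0.
Proof. by rewrite lehmer_euler_denE mulf_neq0 ?invr_neq0 ?pnatr_eq0. Qed.

Lemma exp3_series0 : exp3_series 0 != 0.
Proof. by rewrite invr_neq0 ?pnatr_eq0. Qed.

Lemma lehmer_euler_gfE n : lehmer_euler_gf n = 3 * fps_inv lehmer_euler_den n.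
Proof.
rewrite /lehmer_euler_gf /fps_div /fps_mul big_ord_recl /= subn0.
by rewrite big1 ?addr0 // => k _; rewrite mul0r.
Qed.

Lemma lehmer_euler_gf_exp3 : lehmer_euler_gf =1 fps_inv exp3_series.
Proof.
apply: fps_inv_unique exp3_series0 _ => n.
rewrite -(fps_mulfV lehmer_euler_den0) /fps_mul; apply: eq_bigr => k _.
by rewrite lehmer_euler_gfE lehmer_euler_denE mulrCA mulrA.
Qed.

End LehmerEuler.

(* Main.v *)
Require Import Defs.
From mathcomp Require Import all_boot all_order all_algebra.
From mathcomp Require Import ring zify.

Import GRing.Theory Num.Theory.
Local Open Scope ring_scope.

(** Since [3 %| 'C(3n, m)] whenever [3] does not divide [m], three steps of
    Pascal's rule give
    ['C(3n+3, 3k+3) = 'C(3n, 3k+3) + 'C(3n, 3k)] modulo [9].  Hence the sum of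
    [(-1)^k 'C(3n, 3k)] over [k <= n] telescopes to [0] modulo [9] when
    [n > 0]: the sequence [(-1)^n] satisfies modulo [9] the recurrence
    [\sum_(k <= n) 'C(3n, 3k) W_(3k) = [n = 0]] that determines [W_(3n)]. *)

(** [m * 'C(3 * n, m)] equals [3 * n * 'C((3 * n).-1, m.-1)], and [3] is coprime to [m]. *)
Lemma dvdn3_bin (n m : nat) : ~~ (3 %| m)%N -> (3 %| 'C(3 * n, m))%N.
Proof.
case: m => [//|m] ndvd; have co3m : coprime 3 m.+1 by rewrite prime_coprime.
by rewrite -(Gauss_dvdr _ co3m) -mul_bin_diag -mulnA dvdn_mulr.
Qed.

Lemma bin3S_mod9 (n k : nat) :
  ('C(3 * n.+1, 3 * k.+1) = 'C(3 * n, 3 * k.+1) + 'C(3 * n, 3 * k) %[mod 9])%N.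
Proof.
have /dvdnP [b Eb] : (3 %| 'C(3 * n, (3 * k).+1))%N by apply: dvdn3_bin; lia.
have /dvdnP [c Ec] : (3 %| 'C(3 * n, (3 * k).+2))%N by apply: dvdn3_bin; lia.
rewrite !mulnS !add3n !binS Eb Ec.
set u := 'C(_, _.+3); set v := 'C(_, _).
(* Both middle binomials occur with coefficient [3], so together they contribute [(b + c) * 9]. *)
by rewrite -(modnMDl (b + c) (u + v)); congr (_ %% _)%N; lia.
Qed.

Lemma alt_sum_bin3_mod9 (n : nat) :
  (9 %| \sum_(k < n.+2) (-1) ^+ k * 'C(3 * n.+1, 3 * k)%:Z)%Z.
Proof.
pose u k : int := (-1) ^+ k * 'C(3 * n, 3 * k)%:Z.
have -> : \sum_(k < n.+2) (-1) ^+ k * 'C(3 * n.+1, 3 * k)%:Z =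
  \sum_(k < n.+1) (-1) ^+ k.+1 * ('C(3 * n.+1, 3 * k.+1)%:Z -
     ('C(3 * n, 3 * k.+1) + 'C(3 * n, 3 * k))%N%:Z).
  (* The term [k = 0] is [1]. Since [u n.+1 = 0] and [u 0 = 1], it can be traded for a sum whose
     summands [u k.+1 - u k] are [(-1) ^+ k.+1] times the sum of two binomials being subtracted. *)
  have tel : 1 = - \sum_(k < n.+1) (u k.+1 - u k).
    rewrite -(big_mkord xpredT (fun k => u k.+1 - u k)) telescope_sumr //.
    by rewrite /u muln0 bin0 bin_small ?ltn_pmul2l // mulr0 expr0 mulr1 sub0r opprK.
  rewrite big_ord_recl muln0 bin0 /= expr0 mulr1 [X in X + _]tel addrC.
  rewrite -sumrB; apply: eq_bigr => k _.
  by rewrite /u /bump /= add1n PoszD exprS; ring.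
apply: rpred_sum => k _; apply: dvdz_mull.
by rewrite -eqz_mod_dvd !modz_nat; apply/eqP; congr Posz; apply: bin3S_mod9.
Qed.

Lemma sum_dvdn3 (V : nmodType) (F : nat -> V) (n : nat) :
  \sum_(j < 3 * n) (if (3 %| j)%N then F j else 0) = \sum_(k < n) F (3 * k)%N.
Proof.
elim: n => [|n IHn]; first by rewrite muln0 !big_ord0.
rewrite mulnS add3n !big_ord_recr /= IHn dvdn_mulr //.
by rewrite !ifF ?addr0 //; lia.
Qed.

Lemma lehmer_euler_rec (C : numClosedFieldType) (n : nat) :
  lehmer_euler C (3 * n) = (n == 0%N)%:R -
    \sum_(k < n) 'C(3 * n, 3 * k)%:R * lehmer_euler C (3 * k).
Proof.
have fact_neq0 m : m`!%:R != 0 :> C by rewrite pnatr_eq0 -lt0n fact_gt0.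
rewrite {1}/lehmer_euler lehmer_euler_gf_exp3 fps_invE.
have -> : exp3_series C 0 = 1 by rewrite /exp3_series /= invr1.
rewrite divr1 mulrBr muln_eq0 /=; congr (_ - _).
  by case: n => [|n]; rewrite ?mulr0 // muln0 fact0 mulr1.
rewrite mulr_sumr -(@sum_dvdn3 _ (fun j => 'C(3 * n, j)%:R * lehmer_euler C j)).
apply: eq_bigr => j _; have ltj := ltn_ord j.
(* As [3] divides [3 * n], it divides [3 * n - j] exactly when it divides [j]. *)
rewrite /exp3_series dvdn_subr ?dvdn_mulr ?(ltnW ltj) //.
case: ifP => _; last by rewrite mul0r mulr0.
rewrite /lehmer_euler lehmer_euler_gf_exp3 -(bin_fact (ltnW ltj)) !natrM.
by field.
Qed.

Theorem theorem3 (C : numClosedFieldType) (n : nat) :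
  exists w : int,
    lehmer_euler C (3 * n)%N = w%:~R /\ (w = ((-1) ^+ n)%R %[mod 9])%Z.
Proof.
elim/ltn_ind: n => -[_|n IHn].
  by exists 1; rewrite lehmer_euler_rec big_ord0 subr0.
have /fin_all_exists [w Hw] (k : 'I_n.+1) := IHn k (ltn_ord k).
(* The witness is the recurrence evaluated at the integers [w k] given by induction. *)
exists (- \sum_(k < n.+1) 'C(3 * n.+1, 3 * k)%:Z * w k); split.
  rewrite lehmer_euler_rec sub0r rmorphN rmorph_sum /=; congr (- _).
  by apply: eq_bigr => k _; rewrite rmorphM /= (Hw k).1.
apply/eqP; rewrite eqz_mod_dvd.
(* The first sum collects the errors [w k - (-1) ^+ k], divisible by [9] by induction; the last term
   of the alternating sum, [k = n.+1], supplies [(-1) ^+ n.+1]. *)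
have -> : - (\sum_(k < n.+1) 'C(3 * n.+1, 3 * k)%:Z * w k) - (-1) ^+ n.+1 =
  - (\sum_(k < n.+1) 'C(3 * n.+1, 3 * k)%:Z * (w k - (-1) ^+ k) +
     \sum_(k < n.+2) (-1) ^+ k * 'C(3 * n.+1, 3 * k)%:Z).
  rewrite (big_ord_recr n.+1) /= binn mulr1 addrA -big_split opprD.
  by congr (- _ - _); apply: eq_bigr => k _ /=; ring.
rewrite rpredN rpredD ?alt_sum_bin3_mod9 //.
apply: rpred_sum => k _; apply: dvdz_mull.
by rewrite -eqz_mod_dvd; apply/eqP; apply: (Hw k).2.
Qed.
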